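(* Let $\{U_k\}=\{U_k(P,Q)\}$ be the Lucas sequence with parameters $P,Q$ (nonzero elements) in an arbitrary field $\mathbb{F}$. Let $d_i$ $(0\leq i\leq n)$ be distinct integers. Then the following holds, for integers $k,x$: $$U_{k+x}^n=\sum_{i=0}^{n}U_{k+d_i}^n\prod_{\substack{j=0\\ j\neq i}}^{n}\frac{U_{x-d_j}}{U_{d_i-d_j}}.$$
   Context: For nonzero elements $P,Q$ of a field $\mathbb{F}$, the Lucas sequence $\{U_k(P,Q)\}$ is the sequence in $\mathbb{F}$ defined by $U_{k+2}=PU_{k+1}-QU_k$ with $U_0=0$, $U_1=1$, extended to negative indices by $U_{-k}=-U_k/Q^k$ for $k\geq 1$. One writes $U_k$ for $U_k(P,Q)$. Here $n$ is a nonnegative integer.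
   Formalization: The formula is stated under the added assumption that U_{d_i-d_j} is nonzero for all i ≠ j; distinct d_i alone do not ensure this (for P=Q=1 over the rationals, U_3=0), and otherwise the fractions are undefined. *)

(* Defs.v *)
From mathcomp Require Import all_boot all_order all_algebra.
Set Implicit Arguments.
Unset Strict Implicit.
Unset Printing Implicit Defensive.
Import GRing.Theory.
Local Open Scope ring_scope.

Fixpoint lucas_nat (F : fieldType) (P Q : F) (n : nat) : F :=
  match n with
  | 0%N => 0
  | m.+1 =>
      match m with
      | 0%N => 1
      | l.+1 => P * lucas_nat P Q m - Q * lucas_nat P Q l
      end
  end.

(* [Negz m] is the integer [- m.+1], so the second branch is
   U_{-k} = - U_k / Q^k for k >= 1. *)
Definition lucas (F : fieldType) (P Q : F) (k : int) : F :=
  match k with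
  | Posz n => lucas_nat P Q n
  | Negz m => - lucas_nat P Q m.+1 / Q ^+ m.+1
  end.

(* Main.v *)
Require Import Defs.
From mathcomp Require Import all_boot all_order all_algebra.
From mathcomp Require Import ring.
Set Implicit Arguments.
Unset Strict Implicit.
Unset Printing Implicit Defensive.
Import GRing.Theory.
Local Open Scope ring_scope.

(** The formula is Lagrange interpolation for the [n]-th power of a binary
linear form: [U_(k+x)] is a linear form in the vector [(U_x, U_(x+1))], and
[U_(x-y)] is, up to the factor [Q^y], the determinant of the vectors of [x] and
[y]; the factors [Q^(d_j)] cancel in the quotients.  It follows by induction on
[n] from the case [n = 1], which is the three-term relation
[U_(k+x) = U_(k+a) U_(x-b) / U_(a-b) + U_(k+b) U_(x-a) / U_(b-a)].

The three-term relation ([lucas_two_points]) holds because, as functions of [x],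
both sides satisfy the recurrence [W_(x+2) = P W_(x+1) - Q W_x] on all integers,
and they agree at [x = a] and at [x = b].  Two such agreements suffice: a
solution [W] that vanishes at [a] is the multiple [W_(a+1) U_(x-a)] of the
shifted Lucas sequence, so if it also vanishes at [b] and [U_(b-a)] is nonzero,
then [W_(a+1)] is zero and [W] vanishes identically.

The induction ([interpolation_exp]) uses nothing about Lucas sequences except
the three-term relation.  In the formula for the exponent [n] at the first
[n + 1] nodes, multiply each summand by the three-term relation for its own node
and the new one.  One half of each product is the summand wanted for the old
node; the other halves add up, by the formula for the exponent [n] evaluated at
the new node, to the summand wanted for the new node. *)

Section LucasRecurrence.

Variables (F : fieldType) (P Q : F).

Definition lucas_rec (W : int -> F) : Prop :=
  forall k, W (k + 2) = P * W (k + 1) - Q * W k.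

Lemma lucas_rec_shift W a :
  lucas_rec W -> lucas_rec (fun x => W (a + x)).
Proof. by move=> hW k; rewrite /= !(addrA a k) hW. Qed.

Lemma lucas_rec_lin W V c e : lucas_rec W -> lucas_rec V ->
  lucas_rec (fun x => c * W x + e * V x).
Proof. by move=> hW hV k; rewrite /= hW hV; ring. Qed.

Hypothesis hQ : Q != 0.

(** Since [Q] is invertible, the recurrence can be run backwards too. *)
Lemma lucas_rec_eq0 W : lucas_rec W -> W 0 = 0 -> W 1 = 0 -> forall k, W k = 0.
Proof.
move=> hW W0 W1 k.
suff [] : W k = 0 /\ W (k + 1) = 0 by [].
elim/int_rec: k => [|m [Wm Wm1]|m [Wm Wm1]]; first by rewrite add0r.
  have -> : m.+1%:Z = m%:Z + 1 by rewrite -addn1 PoszD.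
  have -> : m%:Z + 1 + 1 = m%:Z + 2 by ring.
  by rewrite hW Wm Wm1 !mulr0 subr0.
have e1 : - m.+1%:Z + 1 = - m%:Z by rewrite -addn1 PoszD; ring.
have e2 : - m.+1%:Z + 2 = - m%:Z + 1 by rewrite -addn1 PoszD; ring.
split; last by rewrite e1.
move: (hW (- m.+1%:Z)); rewrite e1 e2 Wm Wm1 mulr0 sub0r => /esym/eqP.
by rewrite oppr_eq0 mulf_eq0 (negPf hQ) /= => /eqP.
Qed.

Lemma lucas_recP : lucas_rec (lucas P Q).
Proof.
case=> [m|[|m]].
- have -> : Posz m + 2 = Posz m.+2 by rewrite -(addn2 m) PoszD.
  by have -> : Posz m + 1 = Posz m.+1 by rewrite -(addn1 m) PoszD.
- by rewrite /lucas /= expr1; field.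
have -> : Negz m.+1 + 2 = - m%:Z by rewrite NegzE -addn2 PoszD; ring.
have -> : Negz m.+1 + 1 = Negz m.
  by rewrite !NegzE -(addn1 m.+1) PoszD; ring.
have lucasN j : lucas P Q (- j%:Z) = - lucas_nat P Q j / Q ^+ j.
  by case: j => [|j]; rewrite -?NegzE //= oppr0 mul0r.
have lucasSS : lucas_nat P Q m.+2 = P * lucas_nat P Q m.+1 - Q * lucas_nat P Q m.
  by [].
rewrite lucasN /lucas lucasSS !exprS.
by field; rewrite hQ expf_neq0.
Qed.

(** A solution that vanishes at [a] is the multiple [W (a + 1)] of the Lucas
sequence shifted to [a], because the two agree at [a] and [a + 1]. *)
Lemma lucas_rec_eq0_two_points W a b : lucas_rec W -> W a = 0 -> W b = 0 ->
  lucas P Q (b - a) != 0 -> forall x, W x = 0.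
Proof.
move=> hW Wa Wb Uba.
have Wmul y : W (a + y) = W (a + 1) * lucas P Q y.
  apply/eqP; rewrite -subr_eq0 -mulNr -[W (a + y)]mul1r; apply/eqP.
  apply: (lucas_rec_eq0 (lucas_rec_lin 1 (- W (a + 1))
    (lucas_rec_shift a hW) lucas_recP)).
  - by rewrite addr0 Wa /= !mulr0 addr0.
  - by rewrite /= mulr1 mul1r subrr.
have Wa1 : W (a + 1) = 0.
  have := Wmul (b - a); rewrite subrKC Wb => /esym/eqP.
  by rewrite mulf_eq0 (negPf Uba) orbF => /eqP.
by move=> x; rewrite -(subrKC a x) Wmul Wa1 mul0r.
Qed.

Lemma lucas_two_points (k x a b : int) :
  lucas P Q (a - b) != 0 -> lucas P Q (b - a) != 0 ->
  lucas P Q (k + x) =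
    lucas P Q (k + a) * (lucas P Q (x - b) / lucas P Q (a - b)) +
    lucas P Q (k + b) * (lucas P Q (x - a) / lucas P Q (b - a)).
Proof.
move=> Uab Uba.
pose A := lucas P Q (k + a) / lucas P Q (a - b).
pose B := lucas P Q (k + b) / lucas P Q (b - a).
pose V y := A * lucas P Q (- b + y) + B * lucas P Q (- a + y).
have hV : lucas_rec V.
  by apply: lucas_rec_lin; apply: lucas_rec_shift lucas_recP.
have hW := lucas_rec_lin 1 (-1) (lucas_rec_shift k lucas_recP) hV.
have U0 : lucas P Q 0 = 0 by [].
have := lucas_rec_eq0_two_points hW _ _ Uba x.
rewrite /V /A /B !addNr U0 !(addrC (- _)) => W0.
apply/eqP; rewrite -subr_eq0 -[X in _ == X]W0 //.
- by apply/eqP; ring.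
- by field; rewrite Uab Uba.
- by field; rewrite Uab Uba.
Qed.

End LucasRecurrence.

(** Here [f] plays the role of a linear form and [g x y] that of the determinant
of [x] and [y]; [hfg] is interpolation of [f] at two nodes. *)
Lemma interpolation_exp (F : fieldType) (X : Type) (f : X -> F)
    (g : X -> X -> F)
    (hfg : forall x a b, g a b != 0 -> g b a != 0 ->
      f x = f a * (g x b / g a b) + f b * (g x a / g b a))
    (n : nat) (d : 'I_n.+1 -> X)
    (hd : forall i j, i != j -> g (d i) (d j) != 0) (x : X) :
  f x ^+ n =
  \sum_(i < n.+1) f (d i) ^+ n *
    \prod_(j < n.+1 | j != i) (g x (d j) / g (d i) (d j)).
Proof.
elim: n d hd x => [|n IHn] d hd x.
  by rewrite big_ord1 !expr0 mul1r big_pred0 // => j; rewrite !ord1.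
pose e (i : 'I_n.+1) := d (widen_ord (leqnSn _) i).
pose z := d ord_max.
have widen_neq (i : 'I_n.+1) : widen_ord (leqnSn _) i != ord_max.
  by rewrite -val_eqE /= neq_ltn ltn_ord.
have hez i : g (e i) z != 0 by apply: hd.
have hze i : g z (e i) != 0 by apply: hd; rewrite eq_sym.
have he i j : i != j -> g (e i) (e j) != 0 by move=> ij; apply: hd.
have {}IHn := IHn e he.
rewrite big_ord_recr /= -/z exprSr (IHn x) mulr_suml.
have prod_old i :
    \prod_(j < n.+2 | j != widen_ord (leqnSn _) i) (g x (d j) / g (e i) (d j))
  = (\prod_(j < n.+1 | j != i) (g x (e j) / g (e i) (e j)))
    * (g x z / g (e i) z).
  by rewrite big_mkcond big_ord_recr /= eq_sym widen_neq -big_mkcond.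
have prod_new : \prod_(j < n.+2 | j != ord_max) (g x (d j) / g z (d j))
  = \prod_(j < n.+1) (g x (e j) / g z (e j)).
  rewrite big_mkcond big_ord_recr /= eqxx mulr1.
  by apply: eq_bigr => j _; rewrite widen_neq.
rewrite prod_new exprSr (IHn z) !mulr_suml -big_split /=.
apply: eq_bigr => i _; rewrite prod_old -/(e i).
rewrite {1}(hfg x (e i) z) //.
(* The factors [g z (e j)], [j != i], cancel between the product over all old
   nodes and the coefficient of [f (e i) ^+ n] in [f z ^+ n]. *)
have cancel :
    (\prod_(j < n.+1 | j != i) (g z (e j) / g (e i) (e j)))
      * \prod_(j < n.+1) (g x (e j) / g z (e j))
  = (\prod_(j < n.+1 | j != i) (g x (e j) / g (e i) (e j)))
      * (g x (e i) / g z (e i)).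
  rewrite [X in _ * X](bigD1 i) //= mulrCA mulrC -big_split /=; congr (_ * _).
  by apply: eq_bigr => j ji; field; rewrite hze he // eq_sym.
rewrite [in RHS]exprSr [X in _ = _ + X]mulrAC -[X in _ = _ + X * _]mulrA cancel.
ring.
Qed.

Theorem theorem2 (F : fieldType) (P Q : F) (hP : P != 0) (hQ : Q != 0)
    (n : nat) (d : 'I_n.+1 -> int) (hd : injective d)
    (hU : forall i j : 'I_n.+1, i != j -> lucas P Q (d i - d j) != 0)
    (k x : int) :
  lucas P Q (k + x) ^+ n =
  \sum_(i < n.+1) lucas P Q (k + d i) ^+ n *
    \prod_(j < n.+1 | j != i) (lucas P Q (x - d j) / lucas P Q (d i - d j)).
Proof.
apply: (interpolation_exp (f := fun y => lucas P Q (k + y))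
  (g := fun y z => lucas P Q (y - z))) => // y a b.
exact: lucas_two_points.
Qed.
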